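(* Let $\mathbb{X}$ be a Cartesian difference category with infinitesimal extension $\varepsilon$ and difference combinator $\boldsymbol\partial$. Suppose that $\varepsilon$ is nilpotent, i.e. for every map $f:A\to B$ there is some $k\in\mathbb{N}$ such that $\varepsilon^k(f)=0$, and suppose that for all maps $f:A\to B$ and $x,y,z:C\to A$ $$\varepsilon(\boldsymbol\partial[\boldsymbol\partial[f]])\circ\langle\langle x,y\rangle,\langle z,0\rangle\rangle=\varepsilon^2(\boldsymbol\partial[\boldsymbol\partial[f]])\circ\langle\langle x,y\rangle,\langle z,0\rangle\rangle .$$ Then every derivative $\boldsymbol\partial[f]$ is additive in its second argument: for all $f:A\to B$ and $x,y,z:C\to A$, $\boldsymbol\partial[f]\circ\langle x,y+z\rangle=\boldsymbol\partial[f]\circ\langle x,y\rangle+\boldsymbol\partial[f]\circ\langle x,z\rangle$ and $\boldsymbol\partial[f]\circ\langle x,0\rangle=0$.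
   Context: Composition is written $g\circ f$ (first $f$, then $g$); $\varepsilon^n$ denotes the $n$-fold iterate of the operator $\varepsilon$. A Cartesian category is a category with chosen finite products: binary products $A\times B$ with projections $\pi_0:A\times B\to A$, $\pi_1:A\times B\to B$, pairing $\langle -,-\rangle$, and terminal object $\top$. A left additive category is a category in which each hom-set is a commutative monoid $(+,0)$ with $(f+g)\circ h=f\circ h+g\circ h$ and $0\circ f=0$. A map $k$ is additive if $k\circ(f+g)=k\circ f+k\circ g$ and $k\circ 0=0$. A Cartesian left additive category is a Cartesian category that is also left additive and whose projections are all additive. An infinitesimal extension $\varepsilon$ on a Cartesian left additive category $\mathbb{X}$ consists of functions $\varepsilon:\mathbb{X}(A,B)\to\mathbb{X}(A,B)$ for all $A,B$ such that [E.1] $\varepsilon(f+g)=\varepsilon(f)+\varepsilon(g)$, $\varepsilon(0)=0$; [E.2] $\varepsilon(g\circ f)=\varepsilon(g)\circ f$; [E.3] $\varepsilon(\pi_i)=\pi_i\circ\varepsilon(1_{A\times B})$ for $i=0,1$. A Cartesian difference category is a Cartesian left additive category with an infinitesimal extension $\varepsilon$ and a difference combinator $\boldsymbol\partial$, assigning to each $f:A\to B$ a map $\boldsymbol\partial[f]:A\times A\to B$, such that (for all suitable maps): [C∂.0] $f\circ(x+\varepsilon(y))=f\circ x+\varepsilon(\boldsymbol\partial[f]\circ\langle x,y\rangle)$; [C∂.1] $\boldsymbol\partial[f+g]=\boldsymbol\partial[f]+\boldsymbol\partial[g]$, $\boldsymbol\partial[0]=0$, $\boldsymbol\partial[\varepsilon(f)]=\varepsilon(\boldsymbol\partial[f])$;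 [C∂.2] $\boldsymbol\partial[f]\circ\langle x,y+z\rangle=\boldsymbol\partial[f]\circ\langle x,y\rangle+\boldsymbol\partial[f]\circ\langle x+\varepsilon(y),z\rangle$, $\boldsymbol\partial[f]\circ\langle x,0\rangle=0$; [C∂.3] $\boldsymbol\partial[1_A]=\pi_1$, $\boldsymbol\partial[\pi_0]=\pi_0\circ\pi_1$, $\boldsymbol\partial[\pi_1]=\pi_1\circ\pi_1$; [C∂.4] $\boldsymbol\partial[\langle f,g\rangle]=\langle\boldsymbol\partial[f],\boldsymbol\partial[g]\rangle$; [C∂.5] $\boldsymbol\partial[g\circ f]=\boldsymbol\partial[g]\circ\langle f\circ\pi_0,\boldsymbol\partial[f]\rangle$; [C∂.6] $\boldsymbol\partial[\boldsymbol\partial[f]]\circ\langle\langle x,y\rangle,\langle 0,z\rangle\rangle=\boldsymbol\partial[f]\circ\langle x+\varepsilon(y),z\rangle$; [C∂.7] $\boldsymbol\partial[\boldsymbol\partial[f]]\circ\langle\langle x,y\rangle,\langle z,0\rangle\rangle=\boldsymbol\partial[\boldsymbol\partial[f]]\circ\langle\langle x,z\rangle,\langle y,0\rangle\rangle$. *)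

(* Defs.v *)
Set Implicit Arguments.
Unset Strict Implicit.
Unset Printing Implicit Defensive.

Declare Scope cdc_scope.
Delimit Scope cdc_scope with cdc.

(* Hom-sets are plain types, and maps are compared by Leibniz equality. *)
Record Category := {
  Ob :> Type;
  Hom : Ob -> Ob -> Type;
  idmap : forall A, Hom A A;
  comp : forall A B C, Hom B C -> Hom A B -> Hom A C;
  comp_assoc : forall A B C D (h : Hom C D) (g : Hom B C) (f : Hom A B),
    comp h (comp g f) = comp (comp h g) f;
  comp_id_l : forall A B (f : Hom A B), comp (idmap B) f = f;
  comp_id_r : forall A B (f : Hom A B), comp f (idmap A) = f
}.
Arguments idmap {_} A.
Bind Scope cdc_scope with Hom.
Open Scope cdc_scope.
Notation "g ∘ f" := (comp g f) (at level 40, left associativity) : cdc_scope.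

Record CartesianCategory := {
  cart_cat :> Category;
  prod_ob : cart_cat -> cart_cat -> cart_cat;
  proj0 : forall A B, Hom (prod_ob A B) A;
  proj1 : forall A B, Hom (prod_ob A B) B;
  pairing : forall C A B, Hom C A -> Hom C B -> Hom C (prod_ob A B);
  proj0_pairing : forall C A B (f : Hom C A) (g : Hom C B),
    proj0 A B ∘ pairing f g = f;
  proj1_pairing : forall C A B (f : Hom C A) (g : Hom C B),
    proj1 A B ∘ pairing f g = g;
  pairing_unique : forall C A B (f : Hom C A) (g : Hom C B)
    (h : Hom C (prod_ob A B)),
    proj0 A B ∘ h = f -> proj1 A B ∘ h = g -> h = pairing f g;
  top_ob : cart_cat;
  to_top : forall A, Hom A top_ob;
  to_top_unique : forall A (h : Hom A top_ob), h = to_top A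
}.
Arguments proj0 {_} A B.
Arguments proj1 {_} A B.
Notation "A × B" := (prod_ob A B) (at level 40, left associativity) : cdc_scope.
Notation "⟨ f , g ⟩" := (pairing f g) (at level 0) : cdc_scope.

Record LeftAdditive (X : Category) := {
  zero_map : forall A B : X, Hom A B;
  add_map : forall A B : X, Hom A B -> Hom A B -> Hom A B;
  add_map_assoc : forall (A B : X) (f g h : Hom A B),
    add_map f (add_map g h) = add_map (add_map f g) h;
  add_map_comm : forall (A B : X) (f g : Hom A B), add_map f g = add_map g f;
  add_map_0 : forall (A B : X) (f : Hom A B), add_map (zero_map A B) f = f;
  add_map_comp : forall (A B C : X) (f g : Hom B C) (h : Hom A B),
    add_map f g ∘ h = add_map (f ∘ h) (g ∘ h);
  zero_map_comp : forall (A B C : X) (f : Hom A B),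
    zero_map B C ∘ f = zero_map A C
}.

Definition additive (X : Category) (L : LeftAdditive X) (A B : X)
    (k : Hom A B) : Prop :=
  (forall (C : X) (f g : Hom C A),
     k ∘ add_map L f g = add_map L (k ∘ f) (k ∘ g)) /\
  (forall C : X, k ∘ zero_map L C A = zero_map L C B).

Record CartesianLeftAdditiveCategory := {
  cla_cart :> CartesianCategory;
  cla_add : LeftAdditive cla_cart;
  proj0_additive : forall A B : cla_cart, additive cla_add (proj0 A B);
  proj1_additive : forall A B : cla_cart, additive cla_add (proj1 A B)
}.

Definition zero (X : CartesianLeftAdditiveCategory) (A B : X) : Hom A B :=
  zero_map (cla_add X) A B.
Definition add (X : CartesianLeftAdditiveCategory) (A B : X) (f g : Hom A B) :
  Hom A B := add_map (cla_add X) f g.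
Arguments zero {X A B}.
Arguments add {X A B} f g.
Notation "0" := zero : cdc_scope.
Notation "f + g" := (add f g) (at level 50, left associativity) : cdc_scope.

Record InfinitesimalExtension (X : CartesianLeftAdditiveCategory) := {
  eps :> forall A B : X, Hom A B -> Hom A B;
  eps_add : forall (A B : X) (f g : Hom A B), eps (f + g) = eps f + eps g;
  eps_0 : forall A B : X, eps (0 : Hom A B) = 0;
  eps_comp : forall (A B C : X) (g : Hom B C) (f : Hom A B),
    eps (g ∘ f) = eps g ∘ f;
  eps_proj0 : forall A B : X, eps (proj0 A B) = proj0 A B ∘ eps (idmap (A × B));
  eps_proj1 : forall A B : X, eps (proj1 A B) = proj1 A B ∘ eps (idmap (A × B))
}.

Record DifferenceCombinator (X : CartesianLeftAdditiveCategory)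
    (ε : InfinitesimalExtension X) := {
  diff :> forall A B : X, Hom A B -> Hom (A × A) B;
  diff_eps : forall (A B C : X) (f : Hom A B) (x y : Hom C A),
    f ∘ (x + ε _ _ y) = f ∘ x + ε _ _ (diff f ∘ ⟨x, y⟩);
  diff_add : forall (A B : X) (f g : Hom A B), diff (f + g) = diff f + diff g;
  diff_0 : forall A B : X, diff (0 : Hom A B) = 0;
  diff_of_eps : forall (A B : X) (f : Hom A B), diff (ε _ _ f) = ε _ _ (diff f);
  diff_arg_add : forall (A B C : X) (f : Hom A B) (x y z : Hom C A),
    diff f ∘ ⟨x, y + z⟩ = diff f ∘ ⟨x, y⟩ + diff f ∘ ⟨x + ε _ _ y, z⟩;
  diff_arg_0 : forall (A B C : X) (f : Hom A B) (x : Hom C A),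
    diff f ∘ ⟨x, 0⟩ = 0;
  diff_id : forall A : X, diff (idmap A) = proj1 A A;
  diff_proj0 : forall A B : X,
    diff (proj0 A B) = proj0 A B ∘ proj1 (A × B) (A × B);
  diff_proj1 : forall A B : X,
    diff (proj1 A B) = proj1 A B ∘ proj1 (A × B) (A × B);
  diff_pairing : forall (A B C : X) (f : Hom C A) (g : Hom C B),
    diff ⟨f, g⟩ = ⟨diff f, diff g⟩;
  diff_comp : forall (A B C : X) (g : Hom B C) (f : Hom A B),
    diff (g ∘ f) = diff g ∘ ⟨f ∘ proj0 A A, diff f⟩;
  diff_diff_lin : forall (A B C : X) (f : Hom A B) (x y z : Hom C A),
    diff (diff f) ∘ ⟨⟨x, y⟩, ⟨0, z⟩⟩ = diff f ∘ ⟨x + ε _ _ y, z⟩;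
  diff_diff_sym : forall (A B C : X) (f : Hom A B) (x y z : Hom C A),
    diff (diff f) ∘ ⟨⟨x, y⟩, ⟨z, 0⟩⟩ = diff (diff f) ∘ ⟨⟨x, z⟩, ⟨y, 0⟩⟩
}.

Record CartesianDifferenceCategory := {
  cdc_cla :> CartesianLeftAdditiveCategory;
  cdc_eps : InfinitesimalExtension cdc_cla;
  cdc_diff : DifferenceCombinator cdc_eps
}.

Definition ε (X : CartesianDifferenceCategory) (A B : X) (f : Hom A B) :
  Hom A B := cdc_eps X A B f.
Definition D (X : CartesianDifferenceCategory) (A B : X) (f : Hom A B) :
  Hom (A × A) B := cdc_diff X A B f.
Arguments ε {X A B} f.
Arguments D {X A B} f.
Notation "∂[ f ]" := (D f) (at level 0, format "∂[ f ]") : cdc_scope.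
Notation "ε^ n f" := (Nat.iter n ε f)
  (at level 10, n at level 9, f at level 9, format "ε^ n  f") : cdc_scope.

Definition eps_nilpotent (X : CartesianDifferenceCategory) : Prop :=
  forall (A B : X) (f : Hom A B), exists k : nat, ε^k f = 0.

(* Main.v *)
(** Axiom [C∂.0] applied to [∂[f]] gives
    [∂[f] ∘ ⟨x + ε y, z⟩ = ∂[f] ∘ ⟨x, z⟩ + ε w] with
    [w = ∂[∂[f]] ∘ ⟨⟨x, z⟩, ⟨y, 0⟩⟩].  Since [ε w = ε^2 w], all the iterates
    [ε^(k+1) w] equal [ε w], which is therefore [0] by nilpotency; then [C∂.2]
    is additivity. *)
Require Import Defs.
Open Scope cdc_scope.

Lemma add_0_r (X : CartesianLeftAdditiveCategory) (A B : X) (f : Hom A B) :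
  f + 0 = f.
Proof.
  unfold add, zero. rewrite add_map_comm. apply add_map_0.
Qed.

Lemma pairing_ext (X : CartesianCategory) (A B C : X) (h k : Hom C (A × B)) :
  proj0 A B ∘ h = proj0 A B ∘ k -> proj1 A B ∘ h = proj1 A B ∘ k -> h = k.
Proof.
  intros H0 H1.
  rewrite (pairing_unique H0 H1). symmetry. now apply pairing_unique.
Qed.

(** Additivity of the projections lets both sides be compared after projecting. *)
Lemma pairing_add (X : CartesianLeftAdditiveCategory) (A B C : X)
  (f f' : Hom C A) (g g' : Hom C B) :
  ⟨f, g⟩ + ⟨f', g'⟩ = ⟨f + f', g + g'⟩.
Proof.
  apply pairing_ext; rewrite ?proj0_pairing, ?proj1_pairing; unfold add.
  - destruct (proj0_additive A B) as [-> _]. now rewrite !proj0_pairing.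
  - destruct (proj1_additive A B) as [-> _]. now rewrite !proj1_pairing.
Qed.

Section Epsilon.
Context (X : CartesianLeftAdditiveCategory) (e : InfinitesimalExtension X).

(** By [E.2], [e h] is [e 1 ∘ h], so [E.3], which only concerns the identity, extends to every
    [h]. *)
Lemma proj0_eps (A B C : X) (h : Hom C (A × B)) :
  proj0 A B ∘ e _ _ h = e _ _ (proj0 A B ∘ h).
Proof.
  rewrite eps_comp, eps_proj0, <- comp_assoc, <- eps_comp.
  now rewrite comp_id_l.
Qed.

Lemma proj1_eps (A B C : X) (h : Hom C (A × B)) :
  proj1 A B ∘ e _ _ h = e _ _ (proj1 A B ∘ h).
Proof.
  rewrite eps_comp, eps_proj1, <- comp_assoc, <- eps_comp.
  now rewrite comp_id_l.
Qed.

Lemma eps_pairing (A B C : X) (f : Hom C A) (g : Hom C B) :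
  e _ _ ⟨f, g⟩ = ⟨e _ _ f, e _ _ g⟩.
Proof.
  apply pairing_unique.
  - now rewrite proj0_eps, proj0_pairing.
  - now rewrite proj1_eps, proj1_pairing.
Qed.

End Epsilon.

Lemma eps_idem_nilpotent (X : CartesianDifferenceCategory) :
  eps_nilpotent X ->
  forall (A B : X) (w : Hom A B), ε w = ε (ε w) -> ε w = 0.
Proof.
  intros eps_nil A B w Hw.
  (* Nilpotency is applied to [ε w] rather than [w], so the exponent [k = 0] needs no separate
     case. *)
  assert (H : forall k, ε^k (ε w) = ε w).
  { induction k as [|k IH]; [reflexivity|]. simpl. now rewrite IH. }
  destruct (eps_nil A B (ε w)) as [k Hk]. now rewrite <- (H k).
Qed.

Lemma diff_base_shift (X : CartesianDifferenceCategory) (A B C : X)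
  (f : Hom A B) (x y z : Hom C A) :
  ∂[f] ∘ ⟨x + ε y, z⟩ =
  ∂[f] ∘ ⟨x, z⟩ + ε (∂[∂[f]] ∘ ⟨⟨x, z⟩, ⟨y, 0⟩⟩).
Proof.
  (* [C∂.0] is used from right to left, at the point [⟨x, z⟩] and the increment [⟨y, 0⟩]: the
     perturbation [ε ⟨y, 0⟩ = ⟨ε y, 0⟩] moves only the base point. *)
  unfold ε, D. rewrite <- diff_eps, eps_pairing, eps_0, pairing_add.
  now rewrite add_0_r.
Qed.

Theorem lemma4p9 (X : CartesianDifferenceCategory)
  (eps_nil : eps_nilpotent X)
  (eps_idem : forall (A B C : X) (f : Hom A B) (x y z : Hom C A),
     ε ∂[∂[f]] ∘ ⟨⟨x, y⟩, ⟨z, 0⟩⟩ = ε^2 ∂[∂[f]] ∘ ⟨⟨x, y⟩, ⟨z, 0⟩⟩) :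
  forall (A B C : X) (f : Hom A B) (x y z : Hom C A),
    ∂[f] ∘ ⟨x, y + z⟩ = ∂[f] ∘ ⟨x, y⟩ + ∂[f] ∘ ⟨x, z⟩ /\
    ∂[f] ∘ ⟨x, 0⟩ = 0.
Proof.
  intros A B C f x y z. split; [|apply diff_arg_0].
  assert (H : ε (∂[∂[f]] ∘ ⟨⟨x, z⟩, ⟨y, 0⟩⟩) = 0).
  { apply eps_idem_nilpotent; [assumption|].
    (* The hypothesis applies [ε] to [∂[∂[f]]] before composing; [E.2] carries it over to the
       composite. *)
    specialize (eps_idem A B C f x z y). simpl in eps_idem.
    unfold ε in *. now rewrite !eps_comp. }
  transitivity (∂[f] ∘ ⟨x, y⟩ + ∂[f] ∘ ⟨x + ε y, z⟩); [apply diff_arg_add|].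
  now rewrite diff_base_shift, H, add_0_r.
Qed.
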